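(* Let $n_u\ge 1$, let $\mathcal{Q}\subset\mathbb{R}^{n_u}$ be convex, and let $f$ be a real-valued function that is twice continuously differentiable on $\mathcal{Q}$ and whose gradient is Lipschitz continuous on $\mathcal{Q}$ with constant $L\ge 0$. Let $\mathcal{U}=\{u_0,u_1,\dots,u_{n_u}\}\subset\mathcal{Q}$ and let $U=[\,u_1-u_0,\ \dots,\ u_{n_u}-u_0\,]\in\mathbb{R}^{n_u\times n_u}$. If the columns of $U$ are pairwise orthogonal (not necessarily normalized) and $U$ is nonsingular, then the noise-free simplex gradient $g_t$ satisfies $$\|g_t-\nabla f(u_0)\|\le T_r:=L\,r(\mathcal{U}),$$ where $$r(\mathcal{U})=\frac12\Bigl\|\bigl[\,(u_1-u_0)^{\mathsf T}(u_1-u_0),\ \dots,\ (u_{n_u}-u_0)^{\mathsf T}(u_{n_u}-u_0)\,\bigr]\,U^{-1}\Bigr\|$$ is the radius of the unique sphere that contains all the sample points $u_0,\dots,u_{n_u}$ on its surface.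
   Context: $\|\cdot\|$ denotes the Euclidean norm of a vector (row or column). Vectors $u_j\in\mathbb{R}^{n_u}$ are column vectors and gradients are column vectors. The gradient $\nabla f$ is Lipschitz continuous on $\mathcal{Q}$ with constant $L$ if $\|\nabla f(a)-\nabla f(b)\|\le L\|a-b\|$ for all $a,b\in\mathcal{Q}$. For a sample set $\mathcal{U}=\{u_0,\dots,u_{n_u}\}$ with $U$ nonsingular, the noise-free simplex gradient is $$g_t=(U^{-1})^{\mathsf T}\bigl[f(u_1)-f(u_0),\ \dots,\ f(u_{n_u})-f(u_0)\bigr]^{\mathsf T},$$ i.e. the gradient of the unique affine function interpolating $f$ at the points of $\mathcal{U}$. *)

(* Defs.v *)
From HB Require Import structures.
From mathcomp Require Import all_boot all_order all_algebra.
From mathcomp Require Import all_classical all_reals all_analysis.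

Set Implicit Arguments.
Unset Strict Implicit.
Unset Printing Implicit Defensive.

Import Order.TTheory GRing.Theory Num.Theory.
Import numFieldNormedType.Exports.

Local Open Scope classical_set_scope.
Local Open Scope ring_scope.

(* The library norm `|A| on matrices is the sup norm; [enorm] is the Euclidean
   norm of a row or column vector. *)
Definition enorm (R : realType) (m n : nat) (A : 'M[R]_(m, n)) : R :=
  Num.sqrt (\sum_i \sum_j A i j ^+ 2).

(* Derivatives on [Q] are Frechet derivatives along the filter
   [within Q (nbhs x)], so only the values of [f] on [Q] matter and [Q] need not
   be open. When [Q] is convex with nonempty interior (automatic for a convex
   [Q] containing n + 1 affinely independent points of R^n), the differential is
   unique at every point of [Q], boundary included, and agrees with the ordinary
   one wherever [f] is differentiable in the ordinary sense: see
   [gradient_onE]. *)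
Definition gradient_on (R : realType) (n : nat) (Q : set 'cV[R]_n)
    (f : 'cV[R]_n -> R) (x : 'cV[R]_n) : 'cV[R]_n :=
  \col_i 'd f (within Q (nbhs x)) (delta_mx i 0).

Definition hessian_on (R : realType) (n : nat) (Q : set 'cV[R]_n)
    (f : 'cV[R]_n -> R) (x : 'cV[R]_n) : 'M[R]_n :=
  \matrix_(i, j)
    ('d (gradient_on Q f) (within Q (nbhs x)) (delta_mx j 0) : 'cV[R]_n) i 0.

Definition C2_on (R : realType) (n : nat) (Q : set 'cV[R]_n)
    (f : 'cV[R]_n -> R) : Prop :=
  [/\ forall x, Q x -> differentiable f (within Q (nbhs x)),
      forall x, Q x -> differentiable (gradient_on Q f) (within Q (nbhs x)) &
      {within Q, continuous (hessian_on Q f)}].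

Definition gradient_lipschitz_on (R : realType) (n : nat) (Q : set 'cV[R]_n)
    (f : 'cV[R]_n -> R) (L : R) : Prop :=
  forall a b, Q a -> Q b ->
    enorm (gradient_on Q f a - gradient_on Q f b) <= L * enorm (a - b).

(* A sample set u_0, ..., u_n in R^n is a map on 'I_n.+1; column [j : 'I_n] of
   [sample_mx u] is u_(j+1) - u_0. *)
Definition sample_mx (R : realType) (n : nat) (u : 'I_n.+1 -> 'cV[R]_n) :
    'M[R]_n :=
  \matrix_(i, j) (u (lift ord0 j) - u ord0) i 0.

Definition orthogonal_columns (R : realType) (m n : nat) (A : 'M[R]_(m, n)) :
    Prop :=
  forall j k : 'I_n, j != k -> (col j A)^T *m col k A = 0.

Definition simplex_gradient (R : realType) (n : nat) (u : 'I_n.+1 -> 'cV[R]_n)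
    (f : 'cV[R]_n -> R) : 'cV[R]_n :=
  (invmx (sample_mx u))^T *m \col_j (f (u (lift ord0 j)) - f (u ord0)).

Definition sample_radius (R : realType) (n : nat) (u : 'I_n.+1 -> 'cV[R]_n) :
    R :=
  2^-1 * enorm ((\row_j ((u (lift ord0 j) - u ord0)^T
                          *m (u (lift ord0 j) - u ord0)) 0 0)
                *m invmx (sample_mx u)).

Definition is_circumsphere (R : realType) (n : nat) (u : 'I_n.+1 -> 'cV[R]_n)
    (c : 'cV[R]_n) (rho : R) : Prop :=
  0 < rho /\ forall j, enorm (u j - c) = rho.

Lemma lim_within (R : realType) (n : nat) (Q : set 'cV[R]_n) (x : 'cV[R]_n) :
  Q x -> lim (within Q (nbhs x)) = x.
Proof.
move=> Qx.
have PF : ProperFilter (within Q (nbhs x)).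
  by apply: within_nbhs_proper; exact: subset_closure.
apply: (@cvg_lim _ _ _ _ PF id x).
- exact: norm_hausdorff.
- exact: cvg_within.
Qed.

Lemma differentiable_onP (R : realType) (n : nat) (Q : set 'cV[R]_n)
    (W : normedModType R) (f : 'cV[R]_n -> W) (x : 'cV[R]_n) : Q x ->
  differentiable f (within Q (nbhs x)) ->
  forall e, 0 < e -> \forall y \near within Q (nbhs x),
   `|f y - f x - 'd f (within Q (nbhs x)) (y - x)| <= e * `|y - x|.
Proof.
move=> Qx /diffP[_].
rewrite (lim_within Qx) => H.
pose g := fun y => f x + 'd f (within Q (nbhs x)) (y - x).
move=> e e0.
have : forall e', 0 < e' -> \forall y \near within Q (nbhs x), `|(f - g) y| <= e' * `|y - x|.
  by apply: eqadd_some_oP; apply/funext => y; exact: H.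
move=> /(_ e e0); apply: filterS => y /=.
by rewrite /g !fctE opprD addrA.
Qed.

Lemma diff_on_intro (R : realType) (n : nat) (Q : set 'cV[R]_n)
    (W : normedModType R) (f : 'cV[R]_n -> W) (x : 'cV[R]_n)
    (l : {linear 'cV[R]_n -> W}) : Q x -> continuous l ->
  (forall e, 0 < e -> \forall y \near within Q (nbhs x),
   `|f y - f x - l (y - x)| <= e * `|y - x|) ->
  differentiable f (within Q (nbhs x)).
Proof.
move=> Qx lc H; apply/diffP.
apply: (@getPex _ (fun (df : {linear 'cV[R]_n -> W}) => continuous df /\ forall y,
      f y = f (lim (within Q (nbhs x))) + df (y - lim (within Q (nbhs x))) +o_(y \near (within Q (nbhs x))) (y - lim (within Q (nbhs x))))).
exists l; split=> //; rewrite (lim_within Qx).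
pose g := fun y => f x + l (y - x).
apply: (@eqaddoEx _ _ _ _ _ f g (f - g)) => y.
rewrite littleoE; first by rewrite -[(f - g) y]/(f y - g y) subrKC.
move=> e e0; apply: filterS (H e e0) => z.
by rewrite /g !fctE opprD addrA.
Qed.

Lemma linear_on_unique (R : realType) (n : nat) (Q : set 'cV[R]_n)
    (W : normedModType R) (x : 'cV[R]_n) (l : {linear 'cV[R]_n -> W}) :
  convex_set Q -> Q° !=set0 -> Q x ->
  (forall e, 0 < e -> \forall y \near within Q (nbhs x),
   `|l (y - x)| <= e * `|y - x|) -> forall v, l v = 0.
Proof.
move=> cQ [q0 iq0] Qx H.
have lz z : Q z -> l (z - x) = 0.
  move=> Qz; apply/eqP; rewrite -normr_le0; apply/ler_addgt0Pr => e0 e00.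
  rewrite add0r.
  have d0 : 0 < `|z - x| + 1 by rewrite ltr_wpDl.
  have := H (e0 / (`|z - x| + 1)) (divr_gt0 e00 d0).
  rewrite /prop_near1 /within => /nbhs_ballP[r /= r0 Hr].
  pose t := Num.min 1 (r / (`|z - x| + 1) / 2).
  have rd0 : 0 < r / (`|z - x| + 1) / 2 by rewrite !divr_gt0.
  have t0 : 0 < t by rewrite /t lt_min ltr01 rd0.
  have t1 : t <= 1 by rewrite /t ge_min lexx.
  have := Hr (x + t *: (z - x)).
  rewrite [x + _]addrC addrK linearZ /= !normrZ (gtr0_norm t0).
  have bb : ball x r (t *: (z - x) + x).
    rewrite -ball_normE /ball_ /= opprD addrCA subrr addr0 normrN normrZ (gtr0_norm t0).
    apply: (@le_lt_trans _ _ (r / (`|z - x| + 1) / 2 * (`|z - x|+1))).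
      by apply: ler_pM => //; [exact: ltW|rewrite /t ge_min lexx orbT|rewrite lerDl].
    rewrite mulrAC divfK ?gt_eqF// ltr_pdivrMr// mulr_natr mulr2n ltrDl//.
  have QQ : Q (t *: (z - x) + x).
    have ti : 0 <= t <= 1 by rewrite ltW.
    have tI : Itv.spec (@Itv.num_sem R) (Itv.Real `[0, 1]%Z) t.
      by rewrite /= /Itv.num_sem /= num_real in_itv/= t1 ltW.
    have := cQ z x (Itv.mk tI) (mem_set Qz) (mem_set Qx) => /set_mem.
    rewrite /conv /= /unstable.onem scalerBr scalerBl scale1r.
    by rewrite addrAC addrA.
  move=> /(_ bb QQ); rewrite mulrCA ler_pM2l//.
  move=> /le_trans; apply; rewrite mulrAC ler_pdivrMr// ler_pM2l//.
  by rewrite lerDl.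
move=> v.
move: iq0 => /nbhs_ballP[r /= r0 Hr].
pose s := r / (`|v| + 1) / 2.
have d0 : 0 < `|v| + 1 by rewrite ltr_wpDl.
have s0 : 0 < s by rewrite !divr_gt0.
have Q1 : Q (q0 + s *: v).
  apply: Hr; rewrite -ball_normE /ball_ /= opprD addrA subrr sub0r normrN normrZ (gtr0_norm s0).
  apply: (@le_lt_trans _ _ (s * (`|v|+1))).
    by rewrite ler_pM2l// lerDl.
  by rewrite /s mulrAC divfK ?gt_eqF// ltr_pdivrMr// mulr_natr mulr2n ltrDl.
have Q0 : Q q0 by apply: Hr; exact: ballxx.
have : l ((q0 + s *: v - x) - (q0 - x)) = 0.
  by rewrite linearB /= !lz// subr0.
rewrite opprB addrA subrK addrC addKr linearZ /= => /eqP.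
by rewrite scaler_eq0 gt_eqF//= => /eqP.
Qed.

Lemma gradient_onE (R : realType) (n : nat) (Q : set 'cV[R]_n)
    (f : 'cV[R]_n -> R) (x : 'cV[R]_n) :
  convex_set Q -> Q° !=set0 -> Q x -> differentiable f x ->
  differentiable f (within Q (nbhs x)) /\
  gradient_on Q f x = \col_i 'D_(delta_mx i 0) f x.
Proof.
move=> cQ iQ Qx df.
have H e : 0 < e -> \forall y \near within Q (nbhs x),
   `|f y - f x - 'd f x (y - x)| <= e * `|y - x|.
  move=> e0; have /diffP[_] := df; rewrite (lim_id (@norm_hausdorff _ _)) => K.
  pose g := fun y => f x + 'd f x (y - x).
  have : forall e', 0 < e' -> \forall y \near nbhs x, `|(f - g) y| <= e' * `|y - x|.
    by apply: eqadd_some_oP; apply/funext => y; exact: K.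
  move=> /(_ e e0); apply: filterS => y /= + _.
  by rewrite /g !fctE opprD addrA.
have dw : differentiable f (within Q (nbhs x)).
  by apply: (diff_on_intro Qx _ H); exact: diff_continuous.
split; first exact: dw.
apply/colP => i; rewrite /gradient_on mxE [RHS]mxE (deriveE _ df).
apply/eqP; rewrite -subr_eq0; apply/eqP.
pose l : {linear 'cV[R]_n -> R} := ('d f (within Q (nbhs x)) \- 'd f x).
apply: (@linear_on_unique _ _ Q _ x l) => // e e0.
have e20 : 0 < e / 2 by rewrite divr_gt0.
have := differentiable_onP Qx dw e20.
apply: filterS2 (H _ e20) => y h1 h2.
have aux (p a b : R) : `|b - a| <= `|p - b| + `|p - a|.
  rewrite -normrN opprB (_ : a - b = (p - b) - (p - a)) ?ler_normB//.
  by rewrite opprB [RHS]addrC addrA subrK.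
apply: (le_trans (aux (f y - f x) _ _)).
by apply: (le_trans (lerD h2 h1)); rewrite -mulrDl -splitr.
Qed.

(* Main.v *)
Require Import Defs.
From HB Require Import structures.
From mathcomp Require Import all_boot all_order all_algebra.
From mathcomp Require Import all_classical all_reals all_analysis.
From mathcomp Require Import ring lra.

Set Implicit Arguments.
Unset Strict Implicit.
Unset Printing Implicit Defensive.

Import Order.TTheory GRing.Theory Num.Theory.
Import numFieldNormedType.Exports.

Local Open Scope classical_set_scope.
Local Open Scope ring_scope.

(** Write d_j = u_j - u_0 for the columns of U. Everything is read off the
    numbers d_j . v = (U^T v)_j, which determine v because U is nonsingular.

    The simplex gradient is the vector g with d_j . g = f(u_j) - f(u_0), so its
    error e = g - grad f(u_0) satisfies d_j . e = f(u_j) - f(u_0) -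
    grad f(u_0) . d_j, a first-order Taylor remainder of f on the segment from
    u_0 to u_j. That segment lies in Q by convexity, so the Lipschitz bound gives
    |d_j . e| <= L/2 |d_j|^2 ([taylor1_gradient_lipschitz]).

    The row vector in the definition of the radius is, transposed, the vector s
    with d_j . s = |d_j|^2 ([dotv_diameter]), and r = |s| / 2. Hence
    |d_j . e| <= |d_j . (L/2 s)| for every j. The d_j are orthogonal, so the
    normalized numbers (d_j . v) / |d_j| are the coordinates of v in an
    orthonormal basis, and coordinatewise domination implies domination of norms:
    |e| <= L/2 |s| = L r ([orthogonal_enorm_le]).

    The sphere does not depend on orthogonality. A point u_0 + y is equidistant
    from u_0 and u_j iff |d_j - y| = |y| iff d_j . (2y) = |d_j|^2; over all j this
    says 2y = s. So u_0 + s/2 is the only possible centre, and the radius is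
    |s| / 2 ([is_circumsphereP]). *)

(** * The Euclidean inner product and norm *)

Definition dotv (R : realType) (n : nat) (a b : 'cV[R]_n) : R :=
  (a^T *m b) 0 0.

Lemma dotvE (R : realType) (n : nat) (a b : 'cV[R]_n) :
  dotv a b = \sum_i a i 0 * b i 0.
Proof. by rewrite /dotv mxE; apply: eq_bigr => i _; rewrite mxE. Qed.

Lemma dotvC (R : realType) (n : nat) (a b : 'cV[R]_n) : dotv a b = dotv b a.
Proof. by rewrite !dotvE; apply: eq_bigr => i _; rewrite mulrC. Qed.

Lemma dotvBl (R : realType) (n : nat) (a b c : 'cV[R]_n) :
  dotv (a - b) c = dotv a c - dotv b c.
Proof. by rewrite /dotv linearB mulmxBl mxE [X in _ + X]mxE. Qed.

Lemma dotvZl (R : realType) (n : nat) (k : R) (a c : 'cV[R]_n) :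
  dotv (k *: a) c = k * dotv a c.
Proof. by rewrite /dotv linearZ -scalemxAl mxE. Qed.

Lemma dotvBr (R : realType) (n : nat) (a b c : 'cV[R]_n) :
  dotv c (a - b) = dotv c a - dotv c b.
Proof. by rewrite !(dotvC c) dotvBl. Qed.

Lemma dotvZr (R : realType) (n : nat) (k : R) (a c : 'cV[R]_n) :
  dotv c (k *: a) = k * dotv c a.
Proof. by rewrite !(dotvC c) dotvZl. Qed.

Lemma dotvv_ge0 (R : realType) (n : nat) (a : 'cV[R]_n) : 0 <= dotv a a.
Proof. by rewrite dotvE sumr_ge0// => i _; rewrite -expr2 sqr_ge0. Qed.

Lemma dotvv_eq0 (R : realType) (n : nat) (a : 'cV[R]_n) :
  (dotv a a == 0) = (a == 0).
Proof.
apply/eqP/eqP => [|->]; last by rewrite -(scale0r 0) dotvZl mul0r.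
rewrite dotvE => /eqP; rewrite psumr_eq0 => [/allP a0|i _]; last first.
  by rewrite -expr2 sqr_ge0.
apply/colP => i; rewrite mxE.
by have := a0 i (mem_index_enum i); rewrite mulf_eq0 orbb => /eqP.
Qed.

Lemma enormE (R : realType) (n : nat) (a : 'cV[R]_n) :
  enorm a = Num.sqrt (dotv a a).
Proof.
by rewrite /enorm dotvE; congr Num.sqrt; apply: eq_bigr => i _; rewrite big_ord1.
Qed.

Lemma enorm_ge0 (R : realType) (m n : nat) (A : 'M[R]_(m, n)) : 0 <= enorm A.
Proof. exact: sqrtr_ge0. Qed.

Lemma sqr_enorm (R : realType) (n : nat) (a : 'cV[R]_n) :
  enorm a ^+ 2 = dotv a a.
Proof. by rewrite enormE sqr_sqrtr// dotvv_ge0. Qed.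

Lemma enormZ (R : realType) (n : nat) (k : R) (a : 'cV[R]_n) :
  enorm (k *: a) = `|k| * enorm a.
Proof.
by rewrite !enormE dotvZl dotvZr mulrA -expr2 sqrtrM ?sqr_ge0// sqrtr_sqr.
Qed.

Lemma enormN (R : realType) (n : nat) (a : 'cV[R]_n) : enorm (- a) = enorm a.
Proof. by rewrite -scaleN1r enormZ normrN1 mul1r. Qed.

Lemma enorm_tr (R : realType) (m n : nat) (A : 'M[R]_(m, n)) :
  enorm A^T = enorm A.
Proof.
rewrite /enorm exchange_big; congr Num.sqrt.
by apply: eq_bigr => i _; apply: eq_bigr => j _; rewrite mxE.
Qed.

(** The vector (b.b) a - (a.b) b is (b.b) times the component of a orthogonal to
    b; its square is (b.b) ((a.a)(b.b) - (a.b)^2), which is therefore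
    nonnegative. *)
Lemma cauchy_schwarz (R : realType) (n : nat) (a b : 'cV[R]_n) :
  `|dotv a b| <= enorm a * enorm b.
Proof.
rewrite -ler_sqr ?nnegrE ?mulr_ge0 ?enorm_ge0//.
rewrite real_normK ?num_real// exprMn !sqr_enorm.
have [->|b0] := eqVneq b 0.
  by rewrite -(scale0r 0) dotvZr !dotvZl !mul0r mulr0 expr0n.
have bb : 0 < dotv b b by rewrite lt_def dotvv_eq0 b0 dotvv_ge0.
have := dotvv_ge0 (dotv b b *: a - dotv a b *: b).
rewrite !(dotvBl, dotvBr, dotvZl, dotvZr) (dotvC b a) => h.
rewrite -subr_ge0 -(pmulr_rge0 _ bb); congr (0 <= _): h; ring.
Qed.

(** * Matrices with orthogonal columns *)

Lemma unitmx_col_neq0 (R : realType) (n : nat) (A : 'M[R]_n) (j : 'I_n) :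
  A \in unitmx -> col j A != 0.
Proof.
move=> uA; apply/eqP => Aj0.
have : delta_mx j 0 = 0 :> 'cV[R]_n.
  by rewrite -[LHS](mulKmx uA) -colE Aj0 mulmx0.
by move/matrixP/(_ j 0); rewrite !mxE !eqxx => /eqP; rewrite oner_eq0.
Qed.

(** Parseval's identity in the orthogonal basis formed by the columns of A: since
    A^T A is the diagonal matrix D of squared column lengths, v = A D^-1 A^T v. *)
Lemma orthogonal_parseval (R : realType) (n : nat) (A : 'M[R]_n)
    (v : 'cV[R]_n) :
  A \in unitmx -> orthogonal_columns A ->
  dotv v v = \sum_j (A^T *m v) j 0 ^+ 2 / dotv (col j A) (col j A).
Proof.
move=> uA oA.
pose D j := dotv (col j A) (col j A).
have D0 j : D j != 0 by rewrite dotvv_eq0 unitmx_col_neq0.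
have AA : A^T *m A = diag_mx (\row_j D j).
  apply/matrixP => j k; transitivity (dotv (col j A) (col k A)).
    by rewrite dotvE mxE; apply: eq_bigr => i _; rewrite !mxE.
  rewrite !mxE; have [->|jk] := eqVneq j k; first by rewrite mulr1n.
  by rewrite mulr0n /dotv oA// mxE.
pose w := diag_mx (\row_j (D j)^-1) *m (A^T *m v).
have vE : v = A *m w.
  have uAT : A^T \in unitmx by rewrite unitmx_tr.
  apply: (can_inj (mulKmx uAT)); rewrite mulmxA AA /w mulmxA mulmx_diag.
  rewrite (_ : diag_mx _ = 1%:M) ?mul1mx//.
  by rewrite -diag_const_mx; congr diag_mx; apply/rowP => j; rewrite !mxE divff.
transitivity (dotv w (A^T *m v)).
  by rewrite /dotv [in LHS]vE trmx_mul -mulmxA -vE.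
rewrite dotvE; apply: eq_bigr => j _.
by rewrite /w mul_diag_mx 2!mxE -mulrA mulrC -expr2.
Qed.

(** The step that needs orthogonality: for general A, smaller components along
    the columns do not force a smaller norm. *)
Lemma orthogonal_enorm_le (R : realType) (n : nat) (A : 'M[R]_n)
    (a b : 'cV[R]_n) :
  A \in unitmx -> orthogonal_columns A ->
  (forall j, `|(A^T *m a) j 0| <= `|(A^T *m b) j 0|) ->
  enorm a <= enorm b.
Proof.
move=> uA oA ab.
rewrite !enormE ler_sqrt ?dotvv_ge0// !(orthogonal_parseval _ uA oA).
rewrite ler_sum// => j _; rewrite ler_wpM2r ?invr_ge0 ?dotvv_ge0//.
rewrite -(real_normK (num_real (_ j 0))) -[leRHS]real_normK ?num_real//.
by rewrite ler_sqr ?nnegrE.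
Qed.

(** * First-order Taylor remainder under a Lipschitz gradient *)

(** The mean value theorem applied to phi minus the quadratic
    g 0 * t + K / 2 * t^2, whose derivative at an interior point is at most 0 by
    the bound on g. This avoids integrating g, which need not be continuous. *)
Lemma taylor1_ub (R : realType) (phi g : R -> R) (K : R) :
  (forall t : R, t \in `]0, 1[%R -> is_derive t 1 phi (g t)) ->
  {within `[0, 1], continuous phi} ->
  (forall t : R, t \in `]0, 1[%R -> g t - g 0 <= K * t) ->
  phi 1 - phi 0 - g 0 <= K / 2.
Proof.
move=> dphi cphi gK.
pose p : {poly R} := g 0 *: 'X + (K / 2) *: 'X^2.
have pE t : p.[t] = g 0 * t + K / 2 * t ^+ 2 by rewrite /p !hornerE.
have dpE t : (deriv p).[t] = g 0 + K * t.
  by rewrite /p !poly.derivE !hornerE; field.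
have [|||c c01] := @MVT R (phi - horner p) (fun t => g t - (deriv p).[t]) 0 1 => //.
- by move=> t t01; apply: is_deriveB; exact: dphi.
- move=> t; apply: cvgB; first exact: cphi.
  by apply: continuous_subspaceT => s; exact: continuous_horner.
rewrite !fctE !pE dpE; have := gK c c01.
lra.
Qed.

Lemma taylor1_lipschitz (R : realType) (phi g : R -> R) (K : R) :
  (forall t : R, t \in `]0, 1[%R -> is_derive t 1 phi (g t)) ->
  {within `[0, 1], continuous phi} ->
  (forall t : R, t \in `]0, 1[%R -> `|g t - g 0| <= K * t) ->
  `|phi 1 - phi 0 - g 0| <= K / 2.
Proof.
move=> dphi cphi gK; rewrite ler_norml; apply/andP; split; last first.
  apply: taylor1_ub => // t t01; exact: le_trans (ler_norm _) (gK _ t01).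
rewrite -lerN2 opprK.
have -> : - (phi 1 - phi 0 - g 0) = (- phi) 1 - (- phi) 0 - (- g) 0.
  by rewrite !fctE; ring.
apply: taylor1_ub.
- by move=> t t01; apply: is_deriveN; exact: dphi.
- by move=> t; apply: cvgN; exact: cphi.
move=> t t01; apply: le_trans (gK _ t01).
by rewrite !fctE -opprD -normrN ler_norm.
Qed.

(** The derivative on Q only sees the values of f on Q, so the chain rule along a
    line needs the line to stay in Q on both sides of t. It thus covers interior
    points of a segment of Q, even one that lies in the boundary of Q, but not
    its ends. *)
Lemma is_derive_segment (R : realType) (n : nat) (Q : set 'cV[R]_n)
    (f : 'cV[R]_n -> R) (x d : 'cV[R]_n) (t : R) :
  Q (x + t *: d) -> (\forall s \near t, Q (x + s *: d)) ->
  differentiable f (within Q (nbhs (x + t *: d))) ->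
  is_derive t 1 (fun s => f (x + s *: d))
    ('d f (within Q (nbhs (x + t *: d))) d).
Proof.
move=> Qt Qnear df.
set l := 'd f (within Q (nbhs (x + t *: d))).
suff cv : (fun h => h^-1 *: (((fun s => f (x + s *: d)) \o shift t) (h *: 1)
    - f (x + t *: d))) @ 0^' --> l d.
  by apply: DeriveDef; [apply/cvg_ex; eexists; exact: cv | apply: cvg_lim].
apply/cvgrPdist_le => e e0.
have d0 : 0 < `|d| + 1 by rewrite ltr_wpDl.
have := differentiable_onP Qt df (divr_gt0 e0 d0).
move=> K.
have gc : (fun s => x + s *: d) @ t --> x + t *: d.
  by apply: cvgD; [exact: cvg_cst|apply: cvgZr_tmp; exact: cvg_id].
have sc : (fun h => h *: 1 + t) @ (0 : R) --> t.
  rewrite -[X in _ --> X]add0r -[X in X + t](scale0r 1).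
  by apply: cvgD; [apply: cvgZr_tmp; exact: cvg_id|exact: cvg_cst].
have K2 : \forall s \near t,
    `|f (x + s *: d) - f (x + t *: d) - l (x + s *: d - (x + t *: d))|
      <= e / (`|d| + 1) * `|x + s *: d - (x + t *: d)|.
  by have := gc _ K; apply: filterS2 Qnear => s /= Qs; apply.
have := nbhs_dnbhs (sc _ K2); have := nbhs_dnbhs_neq (0 : R).
apply: filterS2 => h h0 /=.
set y := f _.
rewrite [h *: 1]mulr1 scalerDl.
rewrite (_ : x + _ - _ = h *: d); last by rewrite opprD addrACA subrr add0r addrK.
rewrite linearZ /= normrZ => k.
rewrite -(ler_pM2l (_ : 0 < `|h|)) ?normr_gt0// -normrM.
rewrite (_ : h * _ = - (y - f (x + t *: d) - h *: l d)); last first.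
  by rewrite mulrBr [h^-1 *: _]/(h^-1 * _) mulrA divff// mul1r !opprB.
rewrite normrN; apply: le_trans k _; rewrite mulrCA ler_pM2l ?normr_gt0//.
by rewrite -mulrA ler_piMr ?(ltW e0)// mulrC ler_pdivrMr// mul1r lerDl.
Qed.

(** Continuity relative to Q; this is what remains at the two ends of a segment
    of Q, where two-sided derivatives are unavailable. *)
Lemma differentiable_on_cvg (R : realType) (n : nat) (Q : set 'cV[R]_n)
    (f : 'cV[R]_n -> R) (x : 'cV[R]_n) : Q x ->
  differentiable f (within Q (nbhs x)) ->
  f y @[y --> within Q (nbhs x)] --> f x.
Proof.
move=> Qx df.
set F := within _ _.
set l := 'd f (within Q (nbhs x)).
have x0 : y - x @[y --> F] --> (0 : 'cV[R]_n).
  rewrite -[X in _ --> X](subrr x).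
  by apply: cvgB; [exact: cvg_within|exact: cvg_cst].
have l0 : l (y - x) @[y --> F] --> (0 : R).
  rewrite -(linear0 l).
  have lc : l z @[z --> (0 : 'cV[R]_n)] --> l 0 by exact: diff_continuous.
  exact: cvg_comp x0 lc.
have n0 : `|y - x| @[y --> F] --> (0 : R).
  by rewrite -(normr0 'cV[R]_n); exact: cvg_norm x0.
have r0 : f y - f x - l (y - x) @[y --> F] --> (0 : R).
  apply: norm_cvg0; apply: (squeeze_cvgr _ (cvg_cst 0) n0).
  apply: filterS (differentiable_onP Qx df ltr01) => y.
  by rewrite mul1r normr_ge0.
have -> : f = (fun y => f y - f x - l (y - x) + l (y - x) + f x).
  by apply/funext => y; rewrite !subrK.
rewrite [X in _ --> X](_ : _ = 0 + 0 + f x); last first.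
  by rewrite subrr sub0r subrr linear0 oppr0.
by apply: cvgD; [exact: cvgD|exact: cvg_cst].
Qed.

(** Linearity of the differential: its values on the canonical basis, which make
    up the gradient, determine it. *)
Lemma gradient_onP (R : realType) (n : nat) (Q : set 'cV[R]_n)
    (f : 'cV[R]_n -> R) (x v : 'cV[R]_n) :
  'd f (within Q (nbhs x)) v = dotv (gradient_on Q f x) v.
Proof.
rewrite dotvE {1}(matrix_sum_delta v) linear_sum; apply: eq_bigr => i _.
by rewrite big_ord1 linearZ mxE /= mulrC.
Qed.

Lemma convex_set_segment (R : realType) (n : nat) (Q : set 'cV[R]_n)
    (x d : 'cV[R]_n) (t : R) :
  convex_set Q -> Q x -> Q (x + d) -> 0 <= t <= 1 -> Q (x + t *: d).
Proof.
move=> cQ Qx Qd /andP[t0 t1].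
have tI : Itv.spec (@Itv.num_sem R) (Itv.Real `[0, 1]%Z) t.
  by rewrite /= /Itv.num_sem /= num_real in_itv/= t1 t0.
have := cQ (x + d) x (Itv.mk tI) (mem_set Qd) (mem_set Qx) => /set_mem.
rewrite /conv /= /unstable.onem scalerBl scale1r scalerDr.
by rewrite addrAC addrCA subrr addr0 addrC.
Qed.

(** Along t |-> x + t d the slope grad f(x + t d) . d differs from its value at 0
    by at most L |t d| |d| = L |d|^2 t, by Cauchy-Schwarz. *)
Lemma taylor1_gradient_lipschitz (R : realType) (n : nat) (Q : set 'cV[R]_n)
    (f : 'cV[R]_n -> R) (L : R) (x d : 'cV[R]_n) :
  convex_set Q -> (forall y, Q y -> differentiable f (within Q (nbhs y))) ->
  gradient_lipschitz_on Q f L -> Q x -> Q (x + d) ->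
  `|f (x + d) - f x - dotv (gradient_on Q f x) d| <= L / 2 * dotv d d.
Proof.
move=> cQ df lf Qx Qd.
have Qt t : t \in `[0, 1]%R -> Q (x + t *: d).
  by rewrite in_itv; exact: convex_set_segment.
have Qoo t : t \in `]0, 1[%R -> Q (x + t *: d).
  by move=> t01; apply: Qt; exact: subset_itv_oo_cc.
pose g t := dotv (gradient_on Q f (x + t *: d)) d.
pose phi t := f (x + t *: d).
have := @taylor1_lipschitz R phi g (L * dotv d d).
rewrite /phi /g scale1r scale0r addr0 [leRHS in _ -> _ <= leRHS]mulrAC; apply.
- move=> t t01; rewrite -gradient_onP; apply: is_derive_segment; [exact: Qoo| |].
    by apply: filterS (near_in_itvoo t01) => s; exact: Qoo.
  by apply: df; exact: Qoo.
- apply/subspace_continuousP => t t01.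
  have Qxt : Q (x + t *: d) by exact: Qt.
  apply: cvg_comp _ (differentiable_on_cvg Qxt (df _ Qxt)).
  have gc : (fun s => x + s *: d) @ t --> x + t *: d.
    by apply: cvgD; [exact: cvg_cst|apply: cvgZr_tmp; exact: cvg_id].
  move=> P /gc QP.
  have {}QP : \forall s \near t, Q (x + s *: d) -> P (x + s *: d) by exact: QP.
  suff : \forall s \near t, `[0, 1]%classic s -> P (x + s *: d) by [].
  by apply: filterS QP => s QP s01; apply: QP; exact: Qt.
move=> t t01; have /andP[t0 t1] : 0 < t < 1 by rewrite in_itv in t01.
rewrite -dotvBl.
have CS : `|dotv (gradient_on Q f (x + t *: d) - gradient_on Q f x) d|
   <= enorm (gradient_on Q f (x + t *: d) - gradient_on Q f x) * enorm d.
  exact: cauchy_schwarz.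
apply: le_trans CS _.
have := lf _ _ (Qoo _ t01) Qx; rewrite [x + _]addrC addrK enormZ (gtr0_norm t0) => h.
apply: le_trans (ler_wpM2r (enorm_ge0 _) h) _.
rewrite -sqr_enorm le_eqVlt; apply/orP; left; apply/eqP; ring.
Qed.

(** * The simplex gradient and the circumscribed sphere *)

Lemma sample_mx_trM (R : realType) (n : nat) (u : 'I_n.+1 -> 'cV[R]_n)
    (v : 'cV[R]_n) (j : 'I_n) :
  ((sample_mx u)^T *m v) j 0 = dotv (u (lift ord0 j) - u ord0) v.
Proof. by rewrite mxE dotvE; apply: eq_bigr => i _; rewrite !mxE. Qed.

(** For nonsingular U, twice the vector from u_0 to the centre of the
    circumscribed sphere: u_0 + diameter_vector u is the point of that sphere
    antipodal to u_0. *)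
Definition diameter_vector (R : realType) (n : nat) (u : 'I_n.+1 -> 'cV[R]_n) :
    'cV[R]_n :=
  ((\row_j ((u (lift ord0 j) - u ord0)^T
              *m (u (lift ord0 j) - u ord0)) 0 0)
    *m invmx (sample_mx u))^T.

Lemma sample_radiusE (R : realType) (n : nat) (u : 'I_n.+1 -> 'cV[R]_n) :
  sample_radius u = 2^-1 * enorm (diameter_vector u).
Proof. by rewrite enorm_tr. Qed.

(** Thales: the diameter through u_0 is seen from u_(j+1) at a right angle. *)
Lemma dotv_diameter (R : realType) (n : nat) (u : 'I_n.+1 -> 'cV[R]_n)
    (j : 'I_n) : sample_mx u \in unitmx ->
  dotv (u (lift ord0 j) - u ord0) (diameter_vector u) =
  dotv (u (lift ord0 j) - u ord0) (u (lift ord0 j) - u ord0).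
Proof.
move=> uU; rewrite -sample_mx_trM -trmx_mul mulmxKV//.
by rewrite mxE [LHS]mxE.
Qed.

(** The interpolation conditions that characterize the simplex gradient. *)
Lemma dotv_simplex_gradient (R : realType) (n : nat)
    (u : 'I_n.+1 -> 'cV[R]_n) (f : 'cV[R]_n -> R) (j : 'I_n) :
  sample_mx u \in unitmx ->
  dotv (u (lift ord0 j) - u ord0) (simplex_gradient u f) =
  f (u (lift ord0 j)) - f (u ord0).
Proof.
move=> uU; rewrite -sample_mx_trM /simplex_gradient mulmxA -trmx_mul.
by rewrite mulVmx// trmx1 mul1mx mxE.
Qed.

Lemma sample_mx_tr_inj (R : realType) (n : nat) (u : 'I_n.+1 -> 'cV[R]_n)
    (v w : 'cV[R]_n) : sample_mx u \in unitmx ->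
  (forall j : 'I_n, dotv (u (lift ord0 j) - u ord0) v =
                    dotv (u (lift ord0 j) - u ord0) w) -> v = w.
Proof.
move=> uU vw; have uUT : (sample_mx u)^T \in unitmx by rewrite unitmx_tr.
apply: (can_inj (mulKmx uUT)).
by apply/matrixP => j k; rewrite ord1 !sample_mx_trM.
Qed.

Lemma enorm_sub_eq (R : realType) (n : nat) (d y : 'cV[R]_n) :
  (enorm (d - y) == enorm y) = (dotv d (2 *: y) == dotv d d).
Proof.
rewrite -(eqrXn2 (n := 2))// ?enorm_ge0// !sqr_enorm.
rewrite !(dotvBl, dotvBr, dotvZr) (dotvC y d).
by apply/eqP/eqP => h; lra.
Qed.

(** Equidistance from u_0 and every u_(j+1) is a linear system for the centre with
    matrix U^T, hence has exactly one solution. The bound on n makes the radius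
    positive: it provides a column of U, which is nonzero. *)
Lemma is_circumsphereP (R : realType) (n : nat) (u : 'I_n.+1 -> 'cV[R]_n)
    (c : 'cV[R]_n) (rho : R) :
  (1 <= n)%N -> sample_mx u \in unitmx ->
  is_circumsphere u c rho <->
  c = u ord0 + 2^-1 *: diameter_vector u /\ rho = sample_radius u.
Proof.
move=> n1 uU; set y := c - u ord0.
have cE : c = u ord0 + y by rewrite subrKC.
have enorm0 : enorm (u ord0 - c) = enorm y by rewrite -enormN opprB.
have eq_dist j : (enorm (u (lift ord0 j) - c) == enorm (u ord0 - c)) =
    (dotv (u (lift ord0 j) - u ord0) (2 *: y) ==
     dotv (u (lift ord0 j) - u ord0) (u (lift ord0 j) - u ord0)).
  by rewrite -enorm_sub_eq enorm0 cE opprD !addrA.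
split=> [[rho0 sph]|[cE' ->]].
  have yE : 2 *: y = diameter_vector u.
    apply: (sample_mx_tr_inj uU) => j; rewrite dotv_diameter//.
    by apply/eqP; rewrite -eq_dist !sph.
  rewrite sample_radiusE -yE enormZ scalerA mulVf// scale1r; split=> //.
  by rewrite -(sph ord0) enorm0 ger0_norm// mulrA mulVf// mul1r.
have yE : 2 *: y = diameter_vector u.
  by rewrite /y cE' addrC addKr scalerA divff// scale1r.
have rE : sample_radius u = enorm y.
  by rewrite sample_radiusE -yE enormZ ger0_norm// mulrA mulVf// mul1r.
split; last first.
  move=> j; rewrite rE -enorm0; case: (unliftP ord0 j) => [k ->|->]//.
  by apply/eqP; rewrite eq_dist yE dotv_diameter.
rewrite rE enormE sqrtr_gt0 lt_def dotvv_ge0 andbT dotvv_eq0.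
apply/eqP => y0; have := dotv_diameter (Ordinal n1) uU.
rewrite -yE y0 scaler0 -[X in dotv _ X = _](scale0r 0) dotvZr mul0r.
move=> /esym/eqP; apply/negP; rewrite dotvv_eq0.
rewrite (_ : _ - _ = col (Ordinal n1) (sample_mx u)) ?unitmx_col_neq0//.
by apply/colP => i; rewrite !mxE.
Qed.

Theorem theorem3 (R : realType) (n : nat) (hn : (1 <= n)%N)
    (Q : set 'cV[R]_n) (hQ : convex_set Q)
    (f : 'cV[R]_n -> R) (hf : C2_on Q f)
    (L : R) (hL : 0 <= L) (hLip : gradient_lipschitz_on Q f L)
    (u : 'I_n.+1 -> 'cV[R]_n) (hu : forall j, Q (u j))
    (hortho : orthogonal_columns (sample_mx u))
    (hU : sample_mx u \in unitmx) :
  enorm (simplex_gradient u f - gradient_on Q f (u ord0))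
    <= L * sample_radius u
  /\ exists2 c : 'cV[R]_n,
       is_circumsphere u c (sample_radius u) &
       forall (c' : 'cV[R]_n) (rho : R),
         is_circumsphere u c' rho -> c' = c /\ rho = sample_radius u.
Proof.
split; last first.
  exists (u ord0 + 2^-1 *: diameter_vector u); first exact/is_circumsphereP.
  by move=> c' rho /is_circumsphereP; apply.
have [df _ _] := hf.
rewrite sample_radiusE mulrA -[L * _]ger0_norm ?divr_ge0// -enormZ.
apply: (orthogonal_enorm_le hU hortho) => j; rewrite !sample_mx_trM.
rewrite dotvBr dotvZr dotv_simplex_gradient// dotv_diameter//.
rewrite [leRHS]ger0_norm ?mulr_ge0 ?invr_ge0 ?dotvv_ge0// dotvC.
have uE : u (lift ord0 j) = u ord0 + (u (lift ord0 j) - u ord0).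
  by rewrite subrKC.
rewrite [in X in X - _ - _]uE; apply: taylor1_gradient_lipschitz => //.
by rewrite -uE.
Qed.
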